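(* Let $q$ be a prime power, $n$ a positive integer, $0<t\le n$ an integer and $b=1+q^t$. Assume $(q,n,b)\neq(2,2,3)$ and that the polynomial $\mathrm{Tr}(X)=\mathrm{Tr}_b(X)$ has $m=q^{2n-t-1}+q^{2n-1}$ different roots $\beta_1,\dots,\beta_m$ in $\mathbb{F}_{q^{2n}}$. Define, for $q\neq 2$, $$A(q,t):=\begin{cases} q^n-\lceil\frac{q-1}{2}\rceil q^{n-1}-\lceil\frac{q-1}{2}\rceil q^{n-t-1}-2 & \text{if } 0<t\le \frac n2,\\ q^n-\lceil\frac{q-1}{2}\rceil q^{n-1}-\lceil\frac{q-1}{2}\rceil q^{t-1}-2 & \text{if } \frac n2<t<n,\\ q^{n-1}-2 & \text{if } t=n,\end{cases}$$ and, for $q=2$, $$A(q,t):=\begin{cases}2^n-2^{t-1}-2 & \text{if } t<n,\\ 2^{n-1}-2 & \text{if } t=n.\end{cases}$$ For a nonnegative integer $\tau$ let $\Delta(\tau)=\{a\in\mathbb{Z}\mid 0\le a\le\tau\}$. If $\tau\le A(q,t)$, then the linear code $E_{\Delta(\tau),\mathrm{Tr}}$ over $\mathbb{F}_{q^{2n}}$ has length $m=q^{2n-t-1}+q^{2n-1}$ and satisfies: i) It is Hermitian self-orthogonal, that is, $E_{\Delta(\tau),\mathrm{Tr}}\subseteq (E_{\Delta(\tau),\mathrm{Tr}})^{\perp_h}$. ii) Its dimension is $\tau+1$, and the minimum distance of $(E_{\Delta(\tau),\mathrm{Tr}})^{\perp_h}$ is larger than or equal to $\tau+2$.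
   Context: For a positive integer $j$ put $\mathrm{tr}_j(X)=X+X^q+\cdots+X^{q^{j-1}}$. For $b=1+q^t$ with $0<t\le n$, let $P_b(X)=1+\mathrm{tr}_{2n}(X^b)$ if $0<t<n$, and $P_b(X)=1+\mathrm{tr}_n(X^b)$ if $t=n$. The $b$th trace-depending polynomial $\mathrm{Tr}_b(X)\in\mathbb{F}_{q^{2n}}[X]$ is the representative of minimum degree of the class of $P_b(X)$ in $\mathbb{F}_{q^{2n}}[X]/\langle X^{q^{2n}-1}-1\rangle$. The evaluation map $\mathrm{ev}_{\mathrm{Tr}}:\mathbb{F}_{q^{2n}}[X]/\langle\mathrm{Tr}(X)\rangle\to\mathbb{F}_{q^{2n}}^m$ is $h\mapsto(h(\beta_1),\dots,h(\beta_m))$. For a nonempty $\Delta\subseteq\{0,1,\dots,m-1\}$, $E_{\Delta,\mathrm{Tr}}$ is the $\mathbb{F}_{q^{2n}}$-linear code generated by $\{\mathrm{ev}_{\mathrm{Tr}}(X^i)\mid i\in\Delta\}$. The Hermitian inner product on $\mathbb{F}_{q^{2n}}^m$ is $x\cdot_h y=\sum_{j=1}^m x_jy_j^{q^n}$, and $C^{\perp_h}$ denotes the dual of $C$ with respect to it. *)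

(* Defs.v *)
From HB Require Import structures.
From mathcomp Require Import all_boot all_order all_algebra.

Set Implicit Arguments.
Unset Strict Implicit.
Unset Printing Implicit Defensive.

Import Order.TTheory GRing.Theory Num.Theory.
Local Open Scope ring_scope.

Definition prime_power (q : nat) : Prop :=
  exists p k : nat, [/\ prime p, (0 < k)%N & q = (p ^ k)%N].

Definition tr (F : fieldType) (q j : nat) (f : {poly F}) : {poly F} :=
  \sum_(i < j) f ^+ (q ^ i).

Definition P_poly (F : fieldType) (q n t : nat) : {poly F} :=
  if (t < n)%N then 1 + tr q (2 * n) 'X^(1 + q ^ t)
  else 1 + tr q n 'X^(1 + q ^ t).

(* The remainder is the representative of minimum degree of a class modulo a
   nonzero polynomial, see [modp_mindegP]. *)
Definition Tr_poly (F : fieldType) (q n t : nat) : {poly F} :=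
  P_poly F q n t %% ('X^(q ^ (2 * n) - 1) - 1).

Lemma modp_mindegP (F : fieldType) (d p r : {poly F}) : d != 0 ->
  r = p %% d <->
  (d %| p - r /\ forall s : {poly F}, d %| p - s -> (size r <= size s)%N).
Proof.
move=> d0; have dvd_mod : d %| p - p %% d.
  by rewrite {1}(divp_eq p d) addrK dvdp_mulIr.
split=> [-> | [dr min_r]].
  split=> // s ds.
  case: (ltnP (size s) (size d)) => [s_lt | ds_le].
    by rewrite -(subrK s p) modpD (modp_eq0 ds) add0r modp_small.
  by apply: leq_trans ds_le; apply: ltnW; rewrite ltn_modp.
have r_lt : (size r < size d)%N.
  by apply: leq_ltn_trans (min_r _ dvd_mod) _; rewrite ltn_modp.
by rewrite -(subrK r p) modpD (modp_eq0 dr) add0r modp_small.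
Qed.

Definition num_roots (q n t : nat) : nat :=
  (q ^ (2 * n - t - 1) + q ^ (2 * n - 1))%N.

(* Evaluation is given on representatives; by [ev_eq_mod] it factors through
   the quotient by any polynomial vanishing at all the points. *)
Definition ev (F : fieldType) (m : nat) (beta : 'I_m -> F) (h : {poly F}) :
  'rV[F]_m := \row_j h.[beta j].

Lemma ev_eq_mod (F : fieldType) (m : nat) (beta : 'I_m -> F)
    (T h1 h2 : {poly F}) :
  (forall j, root T (beta j)) -> T %| h1 - h2 -> ev beta h1 = ev beta h2.
Proof.
move=> rT dT; apply/rowP => j; rewrite !mxE; apply/eqP.
rewrite -subr_eq0 -hornerN -hornerD.
by rewrite -/(root _ _) root_factor_theorem (dvdp_trans _ dT) // dvdp_XsubCl.
Qed.

Definition E_code (F : fieldType) (m : nat) (beta : 'I_m -> F)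
    (Delta : seq nat) : {vspace 'rV[F]_m} :=
  <<[seq ev beta 'X^i | i <- Delta]>>%VS.

Definition Delta (tau : nat) : seq nat := iota 0 tau.+1.

Definition herm (F : fieldType) (q n m : nat) (x y : 'rV[F]_m) : F :=
  \sum_(j < m) x 0 j * y 0 j ^+ (q ^ n).

Definition herm_dual (F : finFieldType) (q n m : nat)
    (C : {vspace 'rV[F]_m}) : {set 'rV[F]_m} :=
  [set x | [forall (y | y \in C), herm q n x y == 0]].

Definition hamming_dist (F : fieldType) (m : nat) (x y : 'rV[F]_m) : nat :=
  #|[set j | x 0 j != y 0 j]|.

Definition min_distance (F : finFieldType) (m : nat) (C : {set 'rV[F]_m})
    (d : nat) : Prop :=
  (exists x y, [/\ x \in C, y \in C, x != y & hamming_dist x y = d]) /\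
  (forall x y, x \in C -> y \in C -> x != y -> (d <= hamming_dist x y)%N).

(* Integer-valued: the bound may be negative. [uphalf k] is the ceiling of
   [k / 2]; the exponents never truncate when [0 < t <= n]. *)
Definition A_bound (q n t : nat) : int :=
  let c := uphalf (q - 1) in
  if q != 2 then
    if (2 * t <= n)%N then
      (q ^ n)%:Z - (c * q ^ (n - 1))%:Z - (c * q ^ (n - t - 1))%:Z - 2
    else if (t < n)%N then
      (q ^ n)%:Z - (c * q ^ (n - 1))%:Z - (c * q ^ (t - 1))%:Z - 2
    else (q ^ (n - 1))%:Z - 2
  else
    if (t < n)%N then (2 ^ n)%:Z - (2 ^ (t - 1))%:Z - 2
    else (2 ^ (n - 1))%:Z - 2.

(* Main.v *)
(* Put N = q^n and let P be the polynomial 1 + tr(X^b). Since P(x) lies in the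
   field with q elements, 1 - P(x)^(q-1) is the indicator function of the roots,
   so the sum of x^(i + N j) over the roots is minus the sum over the whole field
   of x^(i + N j) P(x)^(q-1). Expanding the power gives monomials x^(u + N v),
   where u + v is at most i + j plus q-1 times the largest digit sum of b q^k.
   The bound A(q,t) keeps u + v below 2(N-1), whereas a positive multiple of
   N^2 - 1 has digit sum at least 2(N-1); hence every such power sum vanishes,
   which is self-orthogonality. (When q = 2 and t < n the digits u and v have to
   be examined separately.) The dimension and the dual distance follow from
   polynomial interpolation, because tau + 1 < N <= m. *)
Require Import Defs.
From HB Require Import structures.
From mathcomp Require Import all_boot all_order all_algebra.
From mathcomp Require Import finfield zify.
Import Order.TTheory GRing.Theory Num.Theory.
Local Open Scope ring_scope.

(** * Base-[q ^ n] digits of exponents *)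

(** If [a + N * b = M * (N ^ 2 - 1)], then [ga = M] and [al = M * N - b] are the carries. Adding the
    two equations gives [a + b = (al + ga) * (N - 1)]. *)
Lemma base_digits (N a b : nat) : (1 < N)%N -> (N ^ 2 - 1 %| a + N * b)%N ->
  (0 < a + N * b)%N -> exists al ga : nat,
  [/\ (0 < al)%N, (0 < ga)%N, (a + ga = al * N)%N & (b + al = ga * N)%N].
Proof.
move=> N1 /dvdnP[M eM] e0.
have M0 : (0 < M)%N by case: M eM => // h; rewrite h in e0.
have N2 : (M * N ^ 2 = a + N * b + M)%N.
  by rewrite eM mulnBr muln1 subnK // leq_pmulr // expn_gt0; lia.
have lbM : (b < M * N)%N.
  by rewrite -(@ltn_pmul2l N) ?(ltnW N1) // mulnCA mulnn N2; lia.
by exists (M * N - b)%N, M; split; nia.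
Qed.

(* The two base-[N] digits of a positive multiple of [N ^ 2 - 1] sum to at least
   [2 * (N - 1)]. *)
Lemma small_digits_eq0 (N a b : nat) : (1 < N)%N ->
  (a + b < 2 * (N - 1))%N -> (N ^ 2 - 1 %| a + N * b)%N -> (a + N * b = 0)%N.
Proof.
move=> N1 lt dv; apply/eqP; rewrite -leqn0 leqNgt; apply/negP => e0.
have [al [ga [al0 ga0 e1 e2]]] := base_digits _ _ _ N1 dv e0.
nia.
Qed.

(* With [N = q ^ n], [lo_exp + N * hi_exp] is [q ^ k] with its exponent lowered
   by [2 * n] once [2 * n <= k], hence congruent to [q ^ k] modulo [N ^ 2 - 1]. *)
Definition lo_exp (q n k : nat) : nat :=
  if (k < n)%N then (q ^ k)%N else if (k < 2 * n)%N then 0%N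
  else (q ^ (k - 2 * n))%N.

Definition hi_exp (q n k : nat) : nat :=
  if (n <= k < 2 * n)%N then (q ^ (k - n))%N else 0%N.

Definition lo_term (q n t k : nat) : nat := (lo_exp q n k + lo_exp q n (k + t))%N.
Definition hi_term (q n t k : nat) : nat := (hi_exp q n k + hi_exp q n (k + t))%N.

(** Modulo [n], the exponents [k] and [k + t] differ by [t] or [n - t]; the larger is at most
    [n - 1], hence the smaller at most [n - t - 1] or [t - 1]. For [t = n] they coincide. *)
Lemma term_le (q n t k : nat) : (0 < q)%N -> (0 < t)%N -> (t <= n)%N ->
  (k < 2 * n)%N ->
  (lo_term q n t k + hi_term q n t k <=
   q ^ (n - 1) + (if (t < n)%N then
     if (2 * t <= n)%N then q ^ (n - t - 1) else q ^ (t - 1)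
    else q ^ (n - 1)))%N.
Proof.
move=> q0 t0 tn kn; rewrite /lo_term /hi_term /lo_exp /hi_exp.
have X a b : (a <= b)%N -> (q ^ a <= q ^ b)%N by move=> ab; rewrite leq_pexp2l.
repeat case: ifP => ?; try lia; rewrite ?addn0 ?add0n;
  first [ apply: leq_add; apply: X; lia
        | rewrite addnC; apply: leq_add; apply: X; lia ].
Qed.

(** If both powers fall into one digit, their exponents are distinct and below [n], whence the
    factor 3/4. Otherwise [k + t] has just wrapped around, which leaves it an exponent below [t]. *)
Lemma term_cases_2 (n t k : nat) : (0 < t)%N -> (t < n)%N -> (k < 2 * n)%N ->
  let u := lo_term 2 n t k in let v := hi_term 2 n t k in
  [\/ v = 0%N /\ (4 * u <= 3 * 2 ^ n)%N, u = 0%N /\ (4 * v <= 3 * 2 ^ n)%N,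
      (2 * u <= 2 ^ n)%N /\ (v <= 2 ^ (t - 1))%N
    | (u <= 2 ^ (t - 1))%N /\ (2 * v <= 2 ^ n)%N].
Proof.
move=> t0 tn kn /=; rewrite /lo_term /hi_term /lo_exp /hi_exp.
have X a b : (a <= b)%N -> (2 ^ a <= 2 ^ b)%N by move=> ab; rewrite leq_pexp2l.
have X2 a : (a < n)%N -> (2 * 2 ^ a <= 2 ^ n)%N by move=> ?; rewrite -expnS X.
have X4 a : (a.+1 < n)%N -> (4 * 2 ^ a <= 2 ^ n)%N.
  by move=> ?; rewrite -[4%N]/(2 ^ 2)%N -expnD X.
case: (ltnP k n) => kn1; case: (ltnP (k + t) n) => kt1.
- apply: Or41; split => //=; have := X4 k; have := X2 (k + t)%N; lia.
- have -> : (k + t < 2 * n)%N by lia.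
  rewrite /= addn0; apply: Or43; split; [exact: X2 | apply: X; lia].
- lia.
- have -> : (k < 2 * n)%N by lia.
  case: (ltnP (k + t) (2 * n)) => kt2 /=.
    apply: Or42; split => //.
    have := X4 (k - n)%N; have := X2 (k + t - n)%N; lia.
  rewrite addn0 add0n; apply: Or44; split; [apply: X; lia | apply: X2; lia].
Qed.

(* For [q = 2] and [t < n] the bound on [tau] is weaker than what the digit sum
   requires; there [s] has at most one entry and its digits are inspected. *)
Lemma term_exponent_zero (q n t tau J i j : nat) (s : seq (option 'I_J)) :
  (1 < q)%N -> (0 < t)%N -> (t <= n)%N -> tau%:Z <= A_bound q n t ->
  (J <= 2 * n)%N -> (i <= tau)%N -> (j <= tau)%N -> (size s <= q - 1)%N ->
  let e := (i + \sum_(o <- s) oapp (fun k : 'I_J => lo_term q n t k) 0 o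
    + q ^ n * (j + \sum_(o <- s) oapp (fun k : 'I_J => hi_term q n t k) 0 o))%N in
  (q ^ (2 * n) - 1 %| e)%N -> e = 0%N.
Proof.
move=> q1 t0 tn tauA J2n itau jtau ss; cbv zeta.
set u := oapp _ _; set v := oapp _ _.
have n0 : (0 < n)%N by lia.
have N1 : (1 < q ^ n)%N by rewrite -[1%N](exp1n n) ltn_exp2r.
rewrite (mulnC 2%N n) expnM.
have qn1 : (q ^ n = q * q ^ (n - 1))%N by rewrite -expnS; congr expn; lia.
have [qt|/norP[/negPn/eqP q2 /negPn tltn]] := boolP ((q != 2) || ~~ (t < n))%N.
  apply: small_digits_eq0 => //.
  set B := (q ^ (n - 1) + (if (t < n)%N then
     if (2 * t <= n)%N then q ^ (n - t - 1) else q ^ (t - 1)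
    else q ^ (n - 1)))%N.
  have uvB : (\sum_(o <- s) u o + \sum_(o <- s) v o <= size s * B)%N.
    rewrite -big_split /= -sum1_size big_distrl /=.
    apply: leq_sum => -[k|] _ //; rewrite mul1n.
    by apply: term_le => //; [lia | exact: leq_trans J2n].
  have : (size s * B <= (q - 1) * B)%N by rewrite leq_mul2r ss orbT.
  (* The ceiling enters here: for [t < n], [2 * tau + (q - 1) * B] is at most
     [2 * (tau + uphalf (q - 1) * B)], hence at most [2 * (q ^ n - 2)]. *)
  have : (q - 1 <= 2 * uphalf (q - 1))%N by lia.
  move: tauA qt uvB; rewrite /A_bound /B; set c := uphalf _.
  case: ifP => [q2|/negbFE/eqP q2] /=.
    case: ifP => [t2|t2]; [have -> : (t < n)%N by lia | case: (ltnP t n) => tln].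
    - move: (q ^ (n - 1))%N (q ^ (n - t - 1))%N (q ^ n)%N => x y z *; nia.
    - move: (q ^ (n - 1))%N (q ^ (t - 1))%N (q ^ n)%N => x y z *; nia.
    - move: (q ^ (n - 1))%N (q ^ n)%N qn1 => x z *; nia.
  subst q; case: (ltnP t n) => // tln.
  move: (2 ^ (n - 1))%N (2 ^ n)%N qn1 => x z *; nia.
move: tauA; rewrite /A_bound q2 tltn /= => tauA; subst q.
case: s ss => [|o [|]] // _; rewrite ?big_nil ?big_seq1.
  apply: small_digits_eq0 => //.
  move: (2 ^ n)%N (2 ^ (t - 1))%N tauA => *; lia.
case: o => [k|]; rewrite /u /v /=; last first.
  apply: small_digits_eq0 => //.
  move: (2 ^ n)%N (2 ^ (t - 1))%N tauA => *; lia.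
have kn : (k < 2 * n)%N by apply: leq_trans J2n.
have /= := term_cases_2 n t k t0 tltn kn.
have : (0 < 2 ^ (t - 1))%N by rewrite expn_gt0.
have : (4 <= 2 ^ n)%N by rewrite -[4%N]/(2 ^ 2)%N leq_pexp2l //; lia.
move: (2 ^ n)%N (2 ^ (t - 1))%N N1 tauA (lo_term _ _ _ _) (hi_term _ _ _ _).
move=> N T N1 tauA u' v' N4 T0 C dv.
apply/eqP; rewrite -leqn0 leqNgt; apply/negP => e0.
have [al [ga [al0 ga0 e1 e2]]] := base_digits _ _ _ N1 dv e0.
(* The digit sum is [(al + ga) * (N - 1)]. For [al = ga = 1] both digits would be [N - 1], but one
   is at most [tau + T <= N - 2]; the other pairs require a digit [2 * N - 1], which is out of
   reach. *)
have alga : (al + ga <= 3)%N by move: C => [] []; nia.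
have : al = 1%N \/ al = 2%N by lia.
have : ga = 1%N \/ ga = 2%N by lia.
by move: C => [] [? ?] [?|?] [?|?]; subst; lia.
Qed.

(** * Power sums over a finite field *)

Lemma expr_sum_pchar (F : comNzRingType) (m : nat) (I : Type) (r : seq I)
    (P : pred I) (f : I -> F) : [pchar F].-nat m ->
  (\sum_(i <- r | P i) f i) ^+ m = \sum_(i <- r | P i) f i ^+ m.
Proof.
move=> cm; apply: (big_morph (fun x => x ^+ m)) => [x y|].
  exact: exprDn_pchar.
by rewrite expr0n; case: m cm.
Qed.

Lemma prime_power_gt1 (q : nat) : prime_power q -> (1 < q)%N.
Proof.
by case=> p [e [pp e0 ->]]; rewrite -(exp1n e) ltn_exp2r // prime_gt1.
Qed.

Lemma prime_power_pchar (F : finFieldType) (q m : nat) : prime_power q ->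
  #|F| = (q ^ m)%N -> forall k, [pchar F].-nat (q ^ k)%N.
Proof.
move=> [p [e [pp e0 ->]]]; rewrite -expnM => cF k.
by rewrite !pnatX (eq_pnat _ (pcharf_eq (card_finPcharP cF pp))) pnat_id.
Qed.

(** For [e > 0], scaling by [a] multiplies the sum by [a ^+ e]. Some nonzero [a] has [a ^+ e != 1]:
    otherwise all [#|F| - 1] nonzero elements would be roots of unity of the smaller order
    [e %% (#|F| - 1)]. *)
Lemma sum_expr_eq0 (F : finFieldType) (e : nat) :
  ((#|F| - 1 %| e)%N -> e = 0%N) -> \sum_(x : F) x ^+ e = 0.
Proof.
move=> He; have [->|e0] := eqVneq e 0%N.
  (* Translating by 1 shows that the sum of [#|F|] ones vanishes; this is the case [e = 0], with
     [0 ^+ 0 = 1]. *)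
  have : \sum_(x : F) x = \sum_(x : F) (x + 1) := reindex_inj (addIr 1).
  by rewrite big_split /= -{1}[\sum_x x]addr0 => /addrI <-.
case: (pickP [pred a : F | (a != 0) && (a ^+ e != 1)]) => [a /andP[a0 ae]|all1].
  have inj : injective ( *%R a) by exact: mulfI.
  have : \sum_(x : F) x ^+ e = a ^+ e * \sum_(x : F) x ^+ e.
    rewrite {1}(reindex_inj inj) mulr_sumr.
    by apply: eq_bigr => x _; rewrite exprMn.
  move/eqP; rewrite -subr_eq0 -{1}[\sum_x _]mul1r -mulrBl mulf_eq0 subr_eq0.
  by rewrite eq_sym (negPf ae) => /eqP.
case/eqP: e0; apply: He; rewrite subn1 /dvdn.
apply: contraT; rewrite -lt0n => r0.
have F1 := finNzRing_gt1 F.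
have root1 : all (e %% #|F|.-1).-unity_root (enum (predC1 (0 : F))).
  apply/allP => x; rewrite mem_enum inE => x0; rewrite unity_rootE.
  have := all1 x; rewrite /= x0 => /negbFE/eqP xe.
  have xF : x ^+ #|F|.-1 = 1.
    apply: (mulfI x0); rewrite -exprS prednK ?mulr1 ?expf_card //.
    exact: ltnW.
  apply/eqP; rewrite -[RHS]xe {2}(divn_eq e #|F|.-1) exprD mulnC exprM xF.
  by rewrite expr1n mul1r.
have := max_unity_roots r0 root1 (enum_uniq _).
by rewrite -cardE cardC1 leqNgt ltn_mod -subn1 subn_gt0 F1.
Qed.

Lemma sum_option (R : nmodType) (I : finType) (f : option I -> R) :
  \sum_o f o = f None + \sum_i f (Some i).
Proof.
rewrite (bigD1 None) //=; congr (_ + _).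
rewrite (reindex_omap Some id) => [|[]//].
by apply: eq_bigl => i; rewrite /= eqxx.
Qed.

(** * Power sums over the roots of the trace polynomial *)

Section TracePolynomial.
Variables (q n t : nat) (F : finFieldType).
Hypotheses (q_pp : prime_power q) (n_gt0 : (0 < n)%N).
Hypotheses (t_gt0 : (0 < t)%N) (t_le_n : (t <= n)%N).
Hypothesis cardF : #|F| = (q ^ (2 * n))%N.

Let J := if (t < n)%N then (2 * n)%N else n.
(* [None] stands for the constant term [1] of [P_poly]. *)
Let lo (o : option 'I_J) := oapp (fun k : 'I_J => lo_term q n t k) 0%N o.
Let hi (o : option 'I_J) := oapp (fun k : 'I_J => hi_term q n t k) 0%N o.

Lemma expr_term (x : F) (k : nat) :
  x ^+ ((1 + q ^ t) * q ^ k) = x ^+ (lo_term q n t k + q ^ n * hi_term q n t k).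
Proof.
have X j : x ^+ (q ^ j) = x ^+ (lo_exp q n j + q ^ n * hi_exp q n j).
  rewrite /lo_exp /hi_exp; case: (ltnP j n) => jn /=; first by rewrite muln0 addn0.
  case: (ltnP j (2 * n)) => j2n; first by rewrite add0n -expnD subnKC.
  by rewrite muln0 addn0 -{1}(subnKC j2n) expnD -cardF exprM expf_card.
rewrite mulnDl mul1n -expnD exprD (addnC t) !X -exprD.
by rewrite /lo_term /hi_term mulnDr addnACA.
Qed.

Lemma horner_P (x : F) :
  (P_poly F q n t).[x] = \sum_(o : option 'I_J) x ^+ (lo o + q ^ n * hi o).
Proof.
rewrite sum_option /= muln0 expr0.
under eq_bigr do rewrite -expr_term exprM.
rewrite /P_poly /tr /J; case: ifP => _; rewrite hornerD hornerC horner_sum.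
  by congr (_ + _); apply: eq_bigr => i _; rewrite horner_exp hornerXn.
by congr (_ + _); apply: eq_bigr => i _; rewrite horner_exp hornerXn.
Qed.

(* The trace takes its values in the subfield of order [q]. *)
Lemma expr_horner_P (x : F) : (P_poly F q n t).[x] ^+ q = (P_poly F q n t).[x].
Proof.
have cq k : [pchar F].-nat (q ^ k)%N by apply: prime_power_pchar cardF _.
have cq1 : [pchar F].-nat q by rewrite -(expn1 q).
rewrite horner_P sum_option /= muln0 expr0 exprDn_pchar // expr1n; congr (_ + _).
under eq_bigr do rewrite -expr_term exprM.
set y := x ^+ _; rewrite expr_sum_pchar //.
(* For [t = n], [y] is the norm of [x] to the subfield of order [q ^ n], so [J = n] suffices. *)
have yJ : y ^+ (q ^ J) = y.
  rewrite /J; case: (ltnP t n) => tn; first by rewrite -cardF expf_card.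
  have -> : y = x ^+ (1 + q ^ n) by rewrite /y (_ : t = n) //; lia.
  rewrite -exprM mulnDl mul1n -expnD addnn -mul2n exprD -cardF expf_card.
  by rewrite mulrC -exprS.
clearbody y; transitivity (\sum_(i < J) y ^+ (q ^ i.+1)).
  by apply: eq_bigr => i _; rewrite -exprM -expnSr.
have -> : J = J.-1.+1 by rewrite prednK // /J; case: ifP; lia.
rewrite big_ord_recr big_ord_recl /= prednK ?yJ 1?addrC ?expr1 //.
by rewrite /J; case: ifP; lia.
Qed.

(** In the expanded power, [f r] is the term chosen from the factor [r]. *)
Lemma sum_roots_P (k : nat) :
  \sum_(x : F | (P_poly F q n t).[x] == 0) x ^+ k =
  \sum_(x : F) x ^+ k - \sum_(f : {ffun 'I_(q - 1) -> option 'I_J}) \sum_(x : F)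
    x ^+ (k + (\sum_r lo (f r) + q ^ n * \sum_r hi (f r))).
Proof.
have q1 : (0 < q - 1)%N by rewrite subn_gt0 prime_power_gt1.
rewrite exchange_big /= -sumrB big_mkcond /=; apply: eq_bigr => x _.
under eq_bigr do rewrite exprD.
rewrite -mulr_sumr -{2}[x ^+ k]mulr1 -mulrBr.
transitivity (x ^+ k * (1 - (P_poly F q n t).[x] ^+ (q - 1))).
  case: eqP => [->|/eqP P0]; first by rewrite expr0n gtn_eqF // subr0 mulr1.
  have -> : (P_poly F q n t).[x] ^+ (q - 1) = 1; last by rewrite subrr mulr0.
  apply: (mulfI P0); rewrite -exprS mulr1 subn1 prednK ?expr_horner_P //; lia.
congr (_ * (1 - _)).
rewrite horner_P -{1}(card_ord (q - 1)) -prodr_const bigA_distr_bigA /=.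
apply: eq_bigr => f _; rewrite prodrXr; congr (_ ^+ _).
by rewrite big_split big_distrr.
Qed.

Section Bound.
Variable tau : nat.
Hypothesis tau_le : tau%:Z <= A_bound q n t.

Let q_gt1 : (1 < q)%N. Proof. exact: prime_power_gt1. Qed.

Let J_le : (J <= 2 * n)%N. Proof. by rewrite /J; case: ifP; lia. Qed.

Lemma sum_roots_P_eq0 (i j : nat) : (i <= tau)%N -> (j <= tau)%N ->
  \sum_(x : F | (P_poly F q n t).[x] == 0) x ^+ (i + q ^ n * j) = 0.
Proof.
move=> itau jtau; rewrite sum_roots_P.
rewrite [X in X - _]sum_expr_eq0 ?sub0r.
  rewrite big1 ?oppr0 // => f _; apply: sum_expr_eq0; rewrite cardF.
  have := term_exponent_zero q n t tau J i j (codom f) q_gt1 t_gt0 t_le_n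
    tau_le J_le itau jtau.
  rewrite size_map -cardE card_ord leqnn => /(_ isT) /=.
  by rewrite !big_image /= mulnDr addnACA.
rewrite cardF.
have := term_exponent_zero q n t tau J i j [::] q_gt1 t_gt0 t_le_n
  tau_le J_le itau jtau isT.
by rewrite /= !big_nil !addn0.
Qed.

(** Each monomial is the case [i = j = 0] of the digit bound with a single chosen term. *)
Lemma sum_horner_P : \sum_(x : F) (P_poly F q n t).[x] = 0.
Proof.
under eq_bigr do rewrite horner_P.
rewrite exchange_big big1 //= => o _; apply: sum_expr_eq0; rewrite cardF.
have := term_exponent_zero q n t tau J 0 0 [:: o] q_gt1 t_gt0 t_le_n
  tau_le J_le isT isT.
by rewrite /= !big_seq1 !add0n subn_gt0 q_gt1 => /(_ isT).
Qed.

(* Reduction modulo [X ^ (Q - 1) - 1] preserves the values at nonzero points. The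
   value at [0] is preserved too because both polynomials sum to [0] over [F]:
   one has degree less than [Q - 1], for the other see [sum_horner_P]. *)
Lemma root_Tr (x : F) :
  root (Tr_poly F q n t) x = ((P_poly F q n t).[x] == 0).
Proof.
have F1 := finNzRing_gt1 F.
pose d : {poly F} := 'X^(q ^ (2 * n) - 1) - 1.
have TP y : y != 0 -> (Tr_poly F q n t).[y] = (P_poly F q n t).[y].
  move=> y0; rewrite [in RHS](divp_eq (P_poly F q n t) d) hornerD hornerM.
  suff -> : d.[y] = 0 by rewrite mulr0 add0r.
  rewrite /d hornerD hornerN hornerC hornerXn -cardF subn1.
  apply/eqP; rewrite subr_eq0; apply/eqP/(mulfI y0).
  by rewrite -exprS prednK ?mulr1 ?expf_card // ltnW.
rewrite /root; have [->|/TP-> //] := eqVneq x 0.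
suff -> : (Tr_poly F q n t).[0] = (P_poly F q n t).[0] by [].
have szT : (size (Tr_poly F q n t) <= #|F| - 1)%N.
  have sd : size d = (#|F| - 1).+1.
    by rewrite /d -cardF size_XnsubC // subn_gt0.
  by rewrite -ltnS -sd ltn_modp -size_poly_gt0 sd.
have sT : \sum_(y : F) (Tr_poly F q n t).[y] = 0.
  under eq_bigr do rewrite (horner_coef_wide _ szT).
  rewrite exchange_big big1 //= => i _; rewrite -mulr_sumr.
  rewrite sum_expr_eq0 ?mulr0 //; case: (posnP i) => // i0 /(dvdn_leq i0).
  by rewrite leqNgt ltn_ord.
move: sT; rewrite -[RHS]sum_horner_P (bigD1 0) // [RHS](bigD1 0) //=.
by rewrite (eq_bigr _ TP) => /addIr.
Qed.

End Bound.
End TracePolynomial.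

(** * Evaluation codes and their Hermitian duals *)

Section Evaluation.
Variables (F : finFieldType) (m : nat) (beta : 'I_m -> F) (tau : nat).

Let X := [tuple ev beta 'X^i | i < tau.+1].

Lemma E_code_tuple : E_code beta (Delta tau) = <<X>>%VS.
Proof.
rewrite /E_code /Delta; congr span.
by rewrite -val_enum_ord -map_comp.
Qed.

Lemma ev_sum (I : Type) (r : seq I) (P : pred I) (c : I -> F)
    (h : I -> {poly F}) :
  ev beta (\sum_(i <- r | P i) c i *: h i) =
  \sum_(i <- r | P i) c i *: ev beta (h i).
Proof.
apply/rowP => j; rewrite !mxE horner_sum summxE.
by apply: eq_bigr => i _; rewrite hornerZ !mxE.
Qed.

Lemma size_sum_scaleXn (k : nat) (c : 'I_k -> F) :
  (size (\sum_(i < k) c i *: 'X^i : {poly F})%R <= k)%N.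
Proof.
apply: leq_trans (size_sum _ _ _) _; apply/bigmax_leqP => i _.
by apply: leq_trans (size_scale_leq _ _) _; rewrite size_polyXn.
Qed.

Lemma E_codeP (x : 'rV[F]_m) :
  reflect (exists2 h : {poly F}, (size h <= tau.+1)%N & x = ev beta h)
          (x \in E_code beta (Delta tau)).
Proof.
rewrite E_code_tuple; apply: (iffP idP) => [xE|[h szh ->]]; last first.
  rewrite -[h]coefK poly_def ev_sum memv_suml // => i _.
  rewrite memvZ // memv_span //; apply/tnthP.
  by exists (widen_ord szh i); rewrite tnth_mktuple.
exists (\sum_i coord X i x *: 'X^i); first exact: size_sum_scaleXn.
rewrite ev_sum [LHS](coord_span xE); apply: eq_bigr => i _.
by rewrite -tnth_nth tnth_mktuple.
Qed.

Hypothesis beta_inj : injective beta.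

Lemma ev_eq0 (h : {poly F}) : (size h <= m)%N -> ev beta h = 0 -> h = 0.
Proof.
move=> szh /rowP h0; apply: (@roots_geq_poly_eq0 _ h [seq beta j | j <- enum 'I_m]).
- by apply/allP => _ /mapP[j _ ->]; have := h0 j; rewrite !mxE /root => ->.
- by rewrite map_inj_uniq ?enum_uniq.
- by rewrite size_map size_enum_ord.
Qed.

Lemma dim_E_code : (tau < m)%N -> \dim (E_code beta (Delta tau)) = tau.+1.
Proof.
move=> tm; rewrite E_code_tuple; suff /eqP : free X by rewrite size_tuple.
apply/freeP => c; under eq_bigr do rewrite -tnth_nth tnth_mktuple.
rewrite -ev_sum => /(ev_eq0 _) h0 i; have := size_sum_scaleXn _ c.
move=> /leq_trans /(_ tm) /h0 /(congr1 (coefp i)) /=.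
rewrite coef0 coef_sum (bigD1 i) //= coefZ coefXn eqxx mulr1 big1 ?addr0 //.
by move=> k; rewrite -val_eqE eq_sym coefZ coefXn => /negPf->; rewrite mulr0.
Qed.

Variables (q n : nat).
Hypothesis pchar_qn : [pchar F].-nat (q ^ n)%N.

Lemma hermBl (x y z : 'rV[F]_m) : herm q n (x - y) z = herm q n x z - herm q n y z.
Proof. by rewrite /herm -sumrB; apply: eq_bigr => j _; rewrite !mxE mulrBl. Qed.

Lemma herm_dualP (x : 'rV[F]_m) :
  reflect (forall h : {poly F}, (size h <= tau.+1)%N -> herm q n x (ev beta h) = 0)
          (x \in herm_dual q n (E_code beta (Delta tau))).
Proof.
rewrite inE; apply: (iffP forall_inP) => [H h szh|H y /E_codeP[h szh ->]].
  by apply/eqP/H/E_codeP; exists h.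
exact/eqP/H.
Qed.

(** Raising to the power [q ^ n] is additive, so orthogonality to the code need only be tested on
    monomials. *)
Lemma herm_ev (x : 'rV[F]_m) (h : {poly F}) : herm q n x (ev beta h) =
  \sum_(i < size h) h`_i ^+ (q ^ n) * \sum_j x 0 j * (beta j ^+ i) ^+ (q ^ n).
Proof.
under [RHS]eq_bigr do rewrite mulr_sumr.
rewrite exchange_big; apply: eq_bigr => j _ /=.
rewrite mxE horner_coef expr_sum_pchar // mulr_sumr; apply: eq_bigr => i _.
by rewrite exprMn mulrCA.
Qed.

Lemma self_orthogonal :
  (forall i j, (i <= tau)%N -> (j <= tau)%N ->
    \sum_k beta k ^+ (i + q ^ n * j) = 0) ->
  {subset E_code beta (Delta tau) <= herm_dual q n (E_code beta (Delta tau))}.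
Proof.
move=> H _ /E_codeP[g szg ->]; apply/herm_dualP => h szh.
rewrite herm_ev big1 // => j _; rewrite [X in _ * X](_ : _ = 0) ?mulr0 //.
under eq_bigr do rewrite mxE horner_coef mulr_suml.
rewrite exchange_big big1 // => i _ /=.
under eq_bigr do rewrite -mulrA -exprM mulnC -exprD.
rewrite -mulr_sumr H ?mulr0 // -ltnS.
  exact: leq_trans (ltn_ord i) szg.
exact: leq_trans (ltn_ord j) szh.
Qed.

(** Membership in the dual amounts to [tau + 1] linear equations in [m] unknowns. A nonzero solution
    is needed for a minimum distance to exist. *)
Lemma herm_dual_nontrivial : (tau.+1 < m)%N ->
  exists2 x, x \in herm_dual q n (E_code beta (Delta tau)) & x != 0.
Proof.
move=> tm; pose A := \matrix_(j < m, i < tau.+1) (beta j ^+ i) ^+ (q ^ n).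
exists (nz_row (kermx A)); last first.
  rewrite nz_row_eq0 -mxrank_eq0 mxrank_ker -lt0n subn_gt0.
  exact: leq_ltn_trans (rank_leq_col A) tm.
have /sub_kermxP/rowP kA := nz_row_sub (kermx A).
apply/herm_dualP => h szh; rewrite herm_ev big1 // => i _.
have := kA (widen_ord szh i); rewrite [LHS]mxE [RHS]mxE => kAi.
rewrite [X in _ * X](_ : _ = 0) ?mulr0 // -[RHS]kAi.
by apply: eq_bigr => j _; rewrite [in RHS]mxE.
Qed.

(* If [z] had weight at most [tau + 1], the polynomial vanishing at the support
   of [z] except one position would have degree at most [tau]. *)
Lemma herm_dual_weight (z : 'rV[F]_m) :
  z \in herm_dual q n (E_code beta (Delta tau)) -> z != 0 ->
  (tau.+1 < #|[set j | (z 0 j != 0)%R]|)%N.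
Proof.
move=> /herm_dualP zd /rV0Pn[j0 zj0]; rewrite ltnNge; apply/negP => wz.
set S := [set j | _] in wz.
have j0S : j0 \in S by rewrite inE.
pose h := \prod_(j in S :\ j0) ('X - (beta j)%:P).
have hE x : h.[x] = \prod_(j in S :\ j0) (x - beta j).
  by rewrite horner_prod; apply: eq_bigr => j _; rewrite hornerXsubC.
have szh : (size h <= tau.+1)%N.
  rewrite /h -big_enum size_prod_XsubC -cardE.
  by move: wz; rewrite (cardsD1 j0) j0S.
have := zd h szh; rewrite /herm (bigD1 j0) //= big1 => [|j jj0].
  move=> /eqP; rewrite addr0 mulf_eq0 (negPf zj0) mxE expf_eq0 hE.
  case/andP=> _ /prodf_eq0[j]; rewrite !inE => /andP[jj0 _].
  by rewrite subr_eq0 (inj_eq beta_inj) eq_sym (negPf jj0).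
have [->|zj] := eqVneq (z 0 j) 0; first by rewrite mul0r.
rewrite mxE hE (bigD1 j) ?inE ?jj0 //= subrr mul0r expr0n.
(* [pchar_qn] excludes the exponent 0, for which the power of 0 would be 1. *)
by case: (q ^ n)%N pchar_qn => [|k] //=; rewrite mulr0.
Qed.

(** A closest pair of distinct codewords has its difference in the dual, and the distance is the
    weight of that difference. *)
Lemma min_distance_herm_dual : (tau.+1 < m)%N ->
  exists d, min_distance (herm_dual q n (E_code beta (Delta tau))) d /\
    (tau + 2 <= d)%N.
Proof.
move=> tm; set D := herm_dual _ _ _.
have D0 : 0 \in D.
  by apply/herm_dualP => h _; rewrite /herm big1 // => j _; rewrite mxE mul0r.
have [x0 x0D x0n] := herm_dual_nontrivial tm.
pose p (xy : 'rV[F]_m * 'rV[F]_m) := [&& xy.1 \in D, xy.2 \in D & xy.1 != xy.2].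
have p0 : p (x0, 0) by apply/and3P.
have [[x y] /and3P[/= xD yD xy] dmin] :=
  arg_minnP (fun xy => hamming_dist xy.1 xy.2) p0.
exists (hamming_dist x y); split.
  split=> [|x' y' x'D y'D xy']; first by exists x, y.
  by apply: (dmin (x', y')); apply/and3P.
have zD : x - y \in D.
  apply/herm_dualP => h szh; rewrite hermBl.
  by move: xD yD => /herm_dualP-> // /herm_dualP-> //; rewrite subrr.
have := herm_dual_weight _ zD; rewrite subr_eq0 addn2 => /(_ xy).
congr (_ < _)%N; apply: eq_card => j.
by rewrite !inE !mxE subr_eq0.
Qed.

End Evaluation.

(** * Comparison of the bound with the length, and conclusion *)

(** Every case of [A_bound] is at most [q ^ n - 2]. *)
Lemma A_bound_lt (q n t tau : nat) : (1 < q)%N -> (0 < t)%N -> (t <= n)%N ->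
  tau%:Z <= A_bound q n t -> (tau.+1 < q ^ n)%N.
Proof.
move=> q1 t0 tn; rewrite /A_bound.
have Xn : (q ^ (n - 1) <= q ^ n)%N by rewrite leq_pexp2l ?leq_subr // ltnW.
case: eqP Xn => [->|_] Xn /=; [case: ifP => _ | case: ifP => _; [|case: ifP => _]].
- by move: (2 ^ n)%N (2 ^ (t - 1))%N => *; lia.
- by move: (2 ^ n)%N (2 ^ (n - 1))%N Xn => *; lia.
- move: (_ * q ^ (n - 1))%N (_ * q ^ (n - t - 1))%N (q ^ n)%N => *; lia.
- move: (_ * q ^ (n - 1))%N (_ * q ^ (t - 1))%N (q ^ n)%N => *; lia.
- by move: (q ^ n)%N (q ^ (n - 1))%N Xn => *; lia.
Qed.

Theorem theorem14 (q n t : nat) (F : finFieldType)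
  (q_pp : prime_power q) (n_gt0 : (0 < n)%N)
  (t_gt0 : (0 < t)%N) (t_le_n : (t <= n)%N)
  (cardF : #|F| = (q ^ (2 * n))%N)
  (not_223 : (q, n, (1 + q ^ t)%N) <> (2, 2, 3)%N)
  (beta : 'I_(num_roots q n t) -> F)
  (beta_inj : injective beta)
  (beta_roots : forall x : F,
     root (Tr_poly F q n t) x <-> exists j, x = beta j)
  (tau : nat) (tau_le : tau%:Z <= A_bound q n t) :
  let E := E_code beta (Delta tau) in
  [/\ {subset E <= herm_dual q n E},
      \dim E = tau.+1
    & exists d, min_distance (herm_dual q n E) d /\ (tau + 2 <= d)%N].
Proof.
have q_gt1 := prime_power_gt1 _ q_pp.
have tau_lt : (tau.+1 < num_roots q n t)%N.
  apply: leq_trans (A_bound_lt _ _ _ _ q_gt1 t_gt0 t_le_n tau_le) _.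
  apply: leq_trans (leq_addl _ _); rewrite leq_pexp2l ?(ltnW q_gt1) //; lia.
have pchar_qn := prime_power_pchar _ _ _ q_pp cardF n.
move=> E; split.
- apply: self_orthogonal => // i j itau jtau.
  rewrite -[RHS](sum_roots_P_eq0 q n t F q_pp n_gt0 t_gt0 t_le_n cardF tau
    tau_le i j) //.
  (* The roots of [P_poly] in [F] are exactly the values of [beta], so the sum is reindexed along
     this injection. *)
  rewrite (eq_bigl (mem [set beta k | k in setT])) => [|x]; last first.
    rewrite -(root_Tr q n t F q_pp n_gt0 t_gt0 t_le_n cardF tau) //.
    apply/idP/imsetP => [/beta_roots[k ->]|[k _ ->]]; first by exists k.
    by apply/beta_roots; exists k.
  rewrite big_imset /=; last exact: in2W.
  by apply: eq_bigl => k; rewrite inE.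
- by apply: dim_E_code => //; apply: ltnW.
- exact: min_distance_herm_dual.
Qed.
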